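(* Let $k,r\ge 1$ be integers, $p\in(0,1)$, $q=1-p$. Let $Y$ be the waiting time for the $r$-th nonoverlapping success run of length $k$ (negative binomial distribution $\mathrm{NB}_{k,r}$ of Type I). For $j\ge 1$ put $$\tilde F_j=\frac{1}{q^jp^k}\left[(1-p^k)A_j(p)+\sum_{i=1}^{j-1}(-1)^i\binom{j}{i}(kq)^iA_{j-i}(p)\right],$$ where $A_i$ are the Eulerian polynomials. Then for every integer $n\ge 1$ the raw moment $\hat M_n=\mathbb{E}[Y^n]$ is $$\hat M_n=n!\sum_{n_1+2n_2+\dots+kn_k=n}(r+s_n-1)_{s_n}\prod_{j=1}^k\frac{1}{n_j!}\left(\frac{\tilde F_j}{j!}\right)^{n_j},$$ where the sum is over all $k$-tuples $(n_1,\dots,n_k)$ of nonnegative integers with $\sum_{j=1}^k jn_j=n$, and $s_n=n_1+\dots+n_k$.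
   Context: Consider independent Bernoulli trials, indexed $1,2,3,\dots$, each with success probability $p$. Success runs of length $k$ are counted in the nonoverlapping sense: as soon as $k$ consecutive successes are attained, a run is counted and the counting for a new run begins from scratch with the next trial. $Y$ is the index of the trial at which the $r$-th such run is completed; equivalently, $Y$ is the sum of $r$ independent copies of the waiting time for the first run of $k$ consecutive successes. Notation: $(x)_n=x(x-1)\cdots(x-n+1)$ is the falling factorial, with $(x)_0=1$. The Eulerian polynomials $A_i(t)$ are defined by $\sum_{i=0}^\infty A_i(t)\frac{x^i}{i!}=\frac{t-1}{t-e^{(t-1)x}}$; thus $A_0(t)=A_1(t)=1$, $A_2(t)=1+t$, $A_3(t)=1+4t+t^2$.
   Formalization: The sum is over n-tuples (n_1,…,n_n) with ∑ j n_j = n and the product over j=1..n, instead of k-tuples and j=1..k; the two agree for n ≤ k, but the printed formula fails for n > k (k=r=1, n=2 gives 2/p² instead of (2−p)/p²). *)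

(* Defs.v *)
From HB Require Import structures.
From mathcomp Require Import all_boot all_order all_algebra.
From mathcomp Require Import finmap.
From mathcomp Require Import all_classical all_reals all_analysis.

Set Implicit Arguments.
Unset Strict Implicit.
Unset Printing Implicit Defensive.

Import Order.TTheory GRing.Theory Num.Theory.
Import numFieldNormedType.Exports.

Local Open Scope classical_set_scope.
Local Open Scope ring_scope.

(* Mutual independence of a family of random elements: the product rule holds
   for every finite subfamily and every choice of measurable sets. *)
Definition mutually_independent (R : realType) (d : measure_display)
    (T : measurableType d) (P : probability T R) (I : choiceType)
    (d' : measure_display) (T' : measurableType d') (X : I -> T -> T') : Prop :=
  forall (J : {fset I}) (B : I -> set T'), (forall i, measurable (B i)) ->
    P (\bigcap_(i in [set` J]) (X i @^-1` B i)) =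
    (\prod_(i <- J) P (X i @^-1` B i))%E.

(* Independent trials with success probability p; [true] is a success and
   [X i] is the outcome of trial number i + 1. *)
Definition bernoulli_trials (R : realType) (d : measure_display)
    (T : measurableType d) (P : probability T R) (p : R)
    (X : nat -> {RV P >-> bool}) : Prop :=
  (forall i, distribution P (X i) = bernoulli_prob p :> (set bool -> \bar R)) /\
  mutually_independent P (fun i => X i : T -> bool).

(* [run_state k x m = (c, l)] describes the first m trials of the outcome
   sequence x: c nonoverlapping success runs of length k have been counted, and
   the run now in progress, started from scratch after the last counted one,
   has length l. *)
Fixpoint run_state (k : nat) (x : nat -> bool) (m : nat) : nat * nat :=
  if m is m'.+1 then
    let: (c, l) := run_state k x m' in
    if x m' then (if l.+1 == k then (c.+1, 0%N) else (c, l.+1)) else (c, 0%N)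
  else (0%N, 0%N).

Definition run_count (k : nat) (x : nat -> bool) (m : nat) : nat :=
  (run_state k x m).1.

(* Equal to +oo when fewer than r runs are ever completed. *)
Definition waiting_time (R : realType) (k r : nat) (x : nat -> bool) : \bar R :=
  ereal_inf [set (m%:R)%:E | m in [set m | run_count k x m = r]].

(* Formal power series are represented by their sequences of coefficients. *)
Definition series_mul (S : nzRingType) (a b : nat -> S) (n : nat) : S :=
  \sum_(i < n.+1) a i * b (n - i)%N.

Definition series_cst (S : nzRingType) (c : S) (n : nat) : S :=
  if n is 0 then c else 0.

(* The series of e^{c x}. *)
Definition series_exp (R : realType) (c : {poly R}) (n : nat) : {poly R} :=
  (n`!%:R)^-1 *: c ^+ n.

(* sum_i A_i(t) x^i / i! = (t - 1) / (t - e^{(t-1)x}) as formal power series in x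
   over R[t], with t written 'X.  The quotient is expressed by clearing the
   denominator: its constant term t - 1 is not a unit, but it is nonzero, so the
   equation has at most one solution. *)
Definition eulerian_polynomials (R : realType) (A : nat -> {poly R}) : Prop :=
  forall n,
    series_mul (fun i => series_cst 'X i - series_exp ('X - 1) i)
               (fun i => (i`!%:R)^-1 *: A i) n
    = series_cst ('X - 1) n.

Section EulerianPolynomials.
Variable R : realType.
Implicit Types A B : nat -> {poly R}.

Lemma factr_neq0 n : n`!%:R != 0 :> R.
Proof. by rewrite pnatr_eq0 -lt0n fact_gt0. Qed.

Lemma binr_fact n i : (i <= n)%N ->
  n`!%:R * ((i`!%:R)^-1 * ((n - i)`!%:R)^-1) = 'C(n, i)%:R :> R.
Proof.
by move=> le_in; rewrite -(bin_fact le_in) !natrM -invfM mulfK.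
Qed.

Lemma eulerian_polynomialsP A :
  eulerian_polynomials A <->
  A 0%N = 1 /\ forall n, A n.+1 =
    \sum_(i < n.+1) ('C(n.+1, i)%:R * A i * ('X - 1) ^+ (n - i)).
Proof.
have X1 : 'X - 1 != 0 :> {poly R} by rewrite polyXsubC_eq0.
have eq0 : series_mul (fun i => series_cst 'X i - series_exp ('X - 1) i)
    (fun i => (i`!%:R)^-1 *: A i) 0 = ('X - 1) * A 0%N.
  by rewrite /series_mul big_ord_recl big_ord0 /series_exp /= fact0 invr1 !scale1r
    expr0 addr0.
have eqS n : n.+1`!%:R *: series_mul
    (fun i => series_cst 'X i - series_exp ('X - 1) i)
    (fun i => (i`!%:R)^-1 *: A i) n.+1 =
    ('X - 1) * (A n.+1 -
      \sum_(i < n.+1) ('C(n.+1, i)%:R * A i * ('X - 1) ^+ (n - i))).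
  rewrite /series_mul big_ord_recl /series_exp /= fact0 invr1 scale1r expr0 subn0.
  rewrite scalerDr -scalerAr scalerA divff ?factr_neq0// scale1r mulrBr.
  congr (_ + _); rewrite scaler_sumr mulr_sumr -sumrN.
  rewrite [RHS](reindex_inj rev_ord_inj)/=; apply: eq_bigr => i _.
  rewrite /bump /= !add1n sub0r mulNr scalerN -scalerAl -scalerAr !scalerA.
  rewrite !subSS; congr (- _).
  have le_in : (i <= n)%N by rewrite -ltnS.
  rewrite subKn//; have := @binr_fact n.+1 i.+1 (ltn_ord i).
  rewrite subSS mulrA => ->; rewrite -bin_sub ?ltnS// subSS.
  rewrite scaler_nat mulr_natl mulrnAl mulrnAr; congr (_ *+ _).
  by rewrite exprS -mulrA; congr (_ * _); rewrite mulrC.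
split=> [eA|[A0 AS] [|n]]; first split.
- by apply: (mulfI X1); rewrite -eq0 eA mulr1.
- move=> n; apply/eqP; rewrite -subr_eq0; apply/eqP/(mulfI X1).
  by rewrite -eqS eA scaler0 mulr0.
- by rewrite eq0 A0 mulr1.
- apply: (scalerI (factr_neq0 n.+1)).
  by rewrite eqS AS subrr mulr0 scaler0.
Qed.

Lemma eulerian_polynomials_unique A B :
  eulerian_polynomials A -> eulerian_polynomials B -> A =1 B.
Proof.
move=> /eulerian_polynomialsP[A0 AS] /eulerian_polynomialsP[B0 BS].
elim/ltn_ind => -[|n] IH; first by rewrite A0 B0.
by rewrite AS BS; apply: eq_bigr => i _; rewrite IH.
Qed.

Lemma eulerian_polynomials_exist : exists A, eulerian_polynomials A.
Proof.
pose next (s : seq {poly R}) : {poly R} := if size s is n.+1 then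
  \sum_(i < n.+1) ('C(n.+1, i)%:R * s`_i * ('X - 1) ^+ (n - i)) else 1.
pose st := fix st n := if n is m.+1 then rcons (st m) (next (st m)) else [::].
have sz n : size (st n) = n by elim: n => //= n IH; rewrite size_rcons IH.
have st_nth n i : (i < n)%N -> (st n)`_i = next (st i).
  elim: n => // n IH; rewrite ltnS leq_eqVlt => /predU1P[->|lt_in] /=.
    by rewrite nth_rcons sz ltnn eqxx.
  by rewrite nth_rcons sz lt_in IH.
exists (fun n => next (st n)); apply/eulerian_polynomialsP; split=> // n.
rewrite {1}/next sz; apply: eq_bigr => i _.
by rewrite st_nth.
Qed.

End EulerianPolynomials.

Definition Ftilde (R : realType) (A : nat -> {poly R}) (p : R) (k j : nat) : R :=
  let q := 1 - p in
  (q ^+ j * p ^+ k)^-1 *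
  ((1 - p ^+ k) * (A j).[p] +
   \sum_(1 <= i < j)
     (-1) ^+ i * 'C(j, i)%:R * (k%:R * q) ^+ i * (A (j - i)%N).[p]).

(* [m i] plays the role of n_{i+1}; the bound m i <= n built into the type is
   implied by the constraint n_1 + 2 n_2 + ... + n n_n = n.  The number of entries
   is n and not the run length k: Ftilde_j enters the n-th moment for every
   j <= n, and truncating at j <= k fails as soon as k < n (e.g. k = 1, n = 2). *)
Definition weighted_size (n : nat) (m : {ffun 'I_n -> 'I_n.+1}) : nat :=
  (\sum_(i < n) i.+1 * m i)%N.

Definition tuple_size (n : nat) (m : {ffun 'I_n -> 'I_n.+1}) : nat :=
  (\sum_(i < n) m i)%N.

(* Main.v *)
Require Import Defs.
From HB Require Import structures.
From mathcomp Require Import all_boot all_order all_algebra.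
From mathcomp Require Import qpoly.
From mathcomp Require Import ring.
From mathcomp Require Import finmap.
From mathcomp Require Import all_classical all_reals all_analysis.
From mathcomp Require Import measurable_realfun.

Set Implicit Arguments.
Unset Strict Implicit.
Unset Printing Implicit Defensive.

Import Order.TTheory GRing.Theory Num.Theory.
Import numFieldNormedType.Exports.

Local Open Scope classical_set_scope.
Local Open Scope ring_scope.

(** Let q = 1 - p and E = e^t, let Y_c be the waiting time for the c-th run, and
let b_c(m) be the probability that after m trials exactly c runs have been
counted and the run in progress is empty.  Such a fresh state arises at trial m
either because the c-th run is completed there, or because trial m is a failure
that follows l < k successes, themselves preceded by a fresh state; and the
(c+1)-st run is completed by k successes that follow a fresh state:
[[
  b_c(m) = P(Y_c = m) + sum_(l < k) q p^l b_c(m - l - 1),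
  P(Y_(c+1) = m) = p^k b_c(m - k).
]]
Multiplying by e^{mt} and summing over m turns these into identities between
formal power series in t whose coefficients are moments divided by factorials:
[[
  B_c = M_c + q E (sum_(l < k) (p E)^l) B_c,     M_(c+1) = (p E)^k B_c.
]]
The series a(t) = sum_i A_i(p) (t/q)^i / i! satisfies a (1 - p E) = q E by the
definition of the Eulerian polynomials, so that
q E sum_(l < k) (p E)^l = a (1 - (p E)^k), while F(t) = sum_j Ftilde_j t^j / j!
is (a - 1) ((p E)^-k - 1), whence 1 - F = (p E)^-k (1 - a (1 - (p E)^k)).  The
two identities therefore give M_(c+1) (1 - F) = M_c ([run_renewal_equation]),
that is, M_r = (1 - F)^-r since M_0 = 1.  Expanding by the negative binomial
series and the multinomial theorem ([tcoef_negative_binomial]) gives the stated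
coefficient of t^n.

The formal manipulation is legitimate because b_c has an exponential moment
([exponential_moments]), so that all the series of moments converge.  The
recursions for b_c follow from the independence of the next trial and the past
([prefix_independent]).  Finally the constant coefficient of M_r is 1, which
says that the r-th run is almost surely completed; hence the integral of Y^n is
the series of the m^n P(Y = m). *)

(** * Formal power series truncated at a fixed order *)

Section TruncatedSeries.
Variables (R : comNzRingType) (n : nat).
Implicit Types (a b : nat -> R) (p : {poly R}).

(** Computing modulo X^{n+1} instead of with full power series makes the
commutative ring of series available at once, and makes every series without
constant term nilpotent. *)
Definition tseries : comAlgType R := {poly %/ ('X^(n.+1) : {poly R})}.

Definition tpoly p : tseries := in_qpoly 'X^(n.+1) p.

(** An element of the quotient is represented by its remainder, so that for
i <= n its coefficients are those of any representative; see [tcoef_tpoly]. *)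
Definition tcoef (i : nat) (u : tseries) : R := (u : {poly R})`_i.

Lemma tpolyM p1 p2 : tpoly (p1 * p2) = tpoly p1 * tpoly p2.
Proof. exact: in_qpolyM. Qed.

Lemma tpolyD p1 p2 : tpoly (p1 + p2) = tpoly p1 + tpoly p2.
Proof. exact: in_qpolyD. Qed.

Lemma tpolyZ c p : tpoly (c *: p) = c *: tpoly p.
Proof. exact: in_qpolyZ. Qed.

Lemma tpoly1 : tpoly 1 = 1.
Proof. exact: in_qpoly1. Qed.

Lemma tpolyX_exp i : tpoly 'X^i = tpoly 'X ^+ i.
Proof.
by elim: i => [|i IH]; rewrite ?expr0 ?tpoly1// !exprS tpolyM IH.
Qed.

Lemma tcoef_tpoly p i : (i <= n)%N -> tcoef i (tpoly p) = p`_i.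
Proof.
move=> le_in; rewrite -[p in LHS](poly_take_drop n.+1) tpolyD tpolyM.
have -> : tpoly 'X^(n.+1) = 0.
  by apply/val_inj => /=; rewrite mk_monic_Xn Pdiv.RingMonic.rmodpp ?monicXn.
rewrite mulr0 addr0 /tcoef in_qpoly_small ?coef_take_poly ?ltnS ?le_in//.
by rewrite mk_monic_Xn size_polyXn ltnS size_take_poly.
Qed.

Lemma tcoef_sum (I : Type) (t : seq I) (Q : pred I) (F : I -> tseries) i :
  tcoef i (\sum_(j <- t | Q j) F j) = \sum_(j <- t | Q j) tcoef i (F j).
Proof. exact: coefn_sum. Qed.

Lemma tcoefZ c (u : tseries) i : tcoef i (c *: u) = c * tcoef i u.
Proof. exact: coefZ. Qed.

Lemma tseriesP (u v : tseries) :
  (forall i, (i <= n)%N -> tcoef i u = tcoef i v) -> u = v.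
Proof.
move=> uv; apply/npolyP => i; have [/uv//|lt_ni] := leqP i n.
by rewrite !big_coef_npoly// mk_monic_Xn size_polyXn.
Qed.

Definition trunc a : tseries := tpoly (\poly_(i < n.+1) a i).

Lemma tcoef_trunc a i : (i <= n)%N -> tcoef i (trunc a) = a i.
Proof. by move=> le_in; rewrite tcoef_tpoly// coef_poly ltnS le_in. Qed.

Lemma eq_trunc a b : a =1 b -> trunc a = trunc b.
Proof. by move=> ab; apply: tseriesP => i le_in; rewrite !tcoef_trunc ?ab. Qed.

Lemma truncM a b : trunc (series_mul a b) = trunc a * trunc b.
Proof.
rewrite /trunc -tpolyM; apply: tseriesP => i le_in.
rewrite !tcoef_tpoly// coef_poly ltnS le_in coefM.
apply: eq_bigr => j _; rewrite !coef_poly !ltnS.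
by rewrite (leq_trans _ le_in) ?leq_ord// (leq_trans (leq_subr _ _) le_in).
Qed.

Lemma truncD a b : trunc (fun i => a i + b i) = trunc a + trunc b.
Proof.
rewrite /trunc -tpolyD; congr tpoly; apply/polyP => i.
by rewrite coefD !coef_poly; case: ifP => //; rewrite addr0.
Qed.

Lemma truncZ c a : trunc (fun i => c * a i) = c *: trunc a.
Proof.
rewrite /trunc -tpolyZ; congr tpoly; apply/polyP => i.
by rewrite coefZ !coef_poly; case: ifP => //; rewrite mulr0.
Qed.

Lemma trunc_cst c : trunc (series_cst c) = c%:A.
Proof.
rewrite -tpoly1 -tpolyZ alg_polyC.
apply: tseriesP => i le_in; rewrite tcoef_trunc// tcoef_tpoly// coefC.
by case: i {le_in}.
Qed.

Lemma truncB1 a : trunc (fun i => a i - series_cst 1 i) = trunc a - 1.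
Proof.
rewrite -[X in _ - X]scale1r -trunc_cst -[- trunc _]scaleN1r -truncZ -truncD.
by apply: eq_trunc => i; rewrite mulN1r.
Qed.

Lemma trunc_sum a : a 0%N = 0 ->
  trunc a = \sum_(i < n) a i.+1 *: tpoly 'X ^+ i.+1.
Proof.
move=> a0; apply: tseriesP => i le_in; rewrite tcoef_trunc// tcoef_sum.
under eq_bigr => j _ do rewrite tcoefZ -tpolyX_exp tcoef_tpoly// coefXn.
case: i le_in => [_|i lt_in]; first by rewrite a0 big1// => j _; rewrite mulr0.
rewrite (bigD1 (Ordinal lt_in))//= eqxx mulr1 big1 ?addr0// => j.
by rewrite -val_eqE/= eqSS eq_sym => /negPf->; rewrite mulr0.
Qed.

Lemma trunc_nilpotent a : a 0%N = 0 -> trunc a ^+ n.+1 = 0.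
Proof.
move=> a0; rewrite trunc_sum//.
under eq_bigr => i _ do rewrite exprS scalerAr.
rewrite -mulr_sumr exprMn -tpolyX_exp.
suff -> : tpoly 'X^(n.+1) = 0 by rewrite mul0r.
apply: tseriesP => i le_in; rewrite tcoef_tpoly// coefXn ltn_eqF ?ltnS//.
by rewrite /tcoef coef0.
Qed.

End TruncatedSeries.
(** * Multinomial and negative binomial expansions *)

Section DividedPowers.
Variables (R : numFieldType) (S : comAlgType R).
Implicit Types x y : S.

Definition divpow (s : nat) x : S := (s`!%:R)^-1 *: x ^+ s.

Lemma divpowD s x y :
  \sum_(j < s.+1) divpow j x * divpow (s - j) y = divpow s (x + y).
Proof.
rewrite /divpow addrC exprDn scaler_sumr; apply: eq_bigr => j _.
rewrite -scalerAl -scalerAr -[_ *+ 'C(_, _)]scaler_nat !scalerA [y ^+ _ * _]mulrC.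
congr (_ *: _). rewrite -(bin_fact (leq_ord j)) !natrM.
have [C0 j0 sj0] : [/\ 'C(s, j)%:R != 0 :> R, j`!%:R != 0 :> R &
    (s - j)`!%:R != 0 :> R].
  by rewrite !pnatr_eq0 -!lt0n !fact_gt0 bin_gt0 leq_ord.
by field; rewrite C0 j0 sj0.
Qed.

(** The product of the series e^{x_i Y} is e^{(sum x_i) Y}; cutting every factor
at order B leaves the coefficients below B unchanged. *)
Lemma coef_prod_divpow (I : Type) (t : seq I) (x : I -> S) B s : (s < B)%N ->
  (\prod_(i <- t) \poly_(j < B) divpow j (x i))`_s
  = divpow s (\sum_(i <- t) x i).
Proof.
elim: t s => [|i t IH] s lt_sB.
  rewrite !big_nil /divpow expr0n coef1.
  by case: s {lt_sB} => [|s]; rewrite ?fact0 ?invr1 ?scale1r ?scaler0.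
rewrite !big_cons coefM -divpowD; apply: eq_bigr => j _.
rewrite IH ?(leq_ltn_trans (leq_subr _ _) lt_sB)// coef_poly.
by rewrite (leq_ltn_trans (leq_ord j) lt_sB).
Qed.

(** The multinomial theorem, obtained by expanding the product of
[coef_prod_divpow] by distributivity. *)
Lemma multinomial_divpow (I : finType) (x : I -> S) B s : (s < B)%N ->
  divpow s (\sum_i x i) =
  \sum_(m : {ffun I -> 'I_B} | (\sum_i m i == s)%N) \prod_i divpow (m i) (x i).
Proof.
move=> lt_sB; rewrite -(coef_prod_divpow _ _ lt_sB).
under eq_bigr => i _ do rewrite poly_def.
rewrite bigA_distr_bigA/= coef_sum [RHS]big_mkcond; apply: eq_bigr => m _.
rewrite scaler_prod prodrXr coefZ coefXn eq_sym.
by case: eqP => _; rewrite ?mulr1 ?mulr0.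
Qed.

End DividedPowers.

(** Pascal's rule shows that multiplication by 1 - u lowers r by one, up to a
top term that vanishes with u ^+ N.+1.  For r = 0 the truncated difference
0 + s - 1 leaves only the term s = 0. *)
Lemma negative_binomial_inverse (S : comNzRingType) (r N : nat) (u : S) :
  u ^+ N.+1 = 0 ->
  (\sum_(s < N.+1) 'C(r + s - 1, s)%:R * u ^+ s) * (1 - u) ^+ r = 1.
Proof.
move=> u0; elim: r => [|r IH].
  rewrite expr0 mulr1 big_ord_recl bin0 mul1r expr0 big1 ?addr0// => s _.
  by rewrite lift0 add0n subn1 bin_small// mul0r.
rewrite exprS mulrA -[RHS]IH; congr (_ * _).
rewrite mulrBr mulr1 [in X in _ - X]big_ord_recr/= mulrDl -mulrA -exprSr u0.
rewrite mulr0 addr0 mulr_suml !(big_ord_recl N) !bin0 -addrA; congr (_ + _).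
rewrite -sumrB; apply: eq_bigr => s _.
rewrite !lift0 !addSn !addnS !subSS !subn0 -mulrA -exprSr -mulrBl.
by rewrite binS natrD addrK.
Qed.

(** The sum over multiplicity vectors is the coefficient of order n in
(1 - f)^-r: the vectors of size s come from f ^+ s / s!, with weighted size the
degree, and the factor 'C(r + s - 1, s) times s! is the falling factorial. *)
Lemma tcoef_negative_binomial (R : numFieldType) (n r : nat) (f : nat -> R) :
  f 0%N = 0 ->
  tcoef n (\sum_(s < n.+1) 'C(r + s - 1, s)%:R * trunc n f ^+ s) =
  \sum_(m : {ffun 'I_n -> 'I_n.+1} | weighted_size m == n)
    ((r + tuple_size m - 1) ^_ (tuple_size m))%:R *
    \prod_(i < n) (((m i)`!)%:R^-1 * f i.+1 ^+ m i).
Proof.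
move=> f0.
have size_le (m : {ffun 'I_n -> 'I_n.+1}) :
    weighted_size m = n -> (tuple_size m < n.+1)%N.
  move=> wm; rewrite ltnS -[X in (_ <= X)%N]wm; apply: leq_sum => i _.
  by rewrite leq_pmull.
pose w (m : {ffun 'I_n -> 'I_n.+1}) : R :=
  \prod_(i < n) (((m i)`!)%:R^-1 * f i.+1 ^+ m i).
have powE (s : 'I_n.+1) : 'C(r + s - 1, s)%:R * trunc n f ^+ s =
    \sum_(m : {ffun 'I_n -> 'I_n.+1} | tuple_size m == s)
      ((r + s - 1) ^_ s)%:R *: (w m *: tpoly n 'X^(weighted_size m)).
  have -> : 'C(r + s - 1, s)%:R * trunc n f ^+ s =
      ((r + s - 1) ^_ s)%:R *: divpow s (trunc n f).
    by rewrite /divpow scalerA -bin_ffact natrM mulfK ?scaler_nat ?mulr_natl.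
  rewrite trunc_sum// (multinomial_divpow _ (ltn_ord s)) scaler_sumr.
  apply: eq_bigr => m _; congr (_ *: _).
  rewrite tpolyX_exp expr_sum -scaler_prod; apply: eq_bigr => i _.
  by rewrite /divpow exprZn scalerA exprM.
under eq_bigr => s _ do rewrite powE.
rewrite (exchange_big_dep predT)//= tcoef_sum [RHS]big_mkcond/=.
apply: eq_bigr => m _; rewrite tcoef_sum.
under [LHS]eq_bigr => s _ do rewrite !tcoefZ tcoef_tpoly// coefXn eq_sym.
case: eqP => [wm|_]; last by rewrite big1 // => s _; rewrite !mulr0.
by rewrite (big_pred1 (Ordinal (size_le _ wm))) ?mulr1.
Qed.
(** * The generating series of the Eulerian polynomials and of Ftilde *)

Section ExponentialSeries.
Variable R : realType.
Implicit Types c d : R.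

Lemma series_mul_exp c d :
  series_mul (exp_coeff c) (exp_coeff d) =1 exp_coeff (c + d).
Proof.
move=> s; rewrite /series_mul !exp_coeffE.
exact: (@divpowD R R^o s c d).
Qed.

Lemma trunc_exp0 n : trunc n (exp_coeff (0 : R)) = 1.
Proof.
rewrite -[RHS]scale1r -trunc_cst; apply: eq_trunc => -[|i].
  by rewrite /exp_coeff/= fact0 divr1.
by rewrite /exp_coeff/= expr0n mul0r.
Qed.

Lemma trunc_expD n c d :
  trunc n (exp_coeff (c + d)) = trunc n (exp_coeff c) * trunc n (exp_coeff d).
Proof. by rewrite -truncM; apply/esym/eq_trunc/series_mul_exp. Qed.

Lemma trunc_expX n c l :
  trunc n (exp_coeff (l%:R * c)) = trunc n (exp_coeff c) ^+ l.
Proof.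
elim: l => [|l IH]; first by rewrite mul0r trunc_exp0.
by rewrite -addn1 natrD mulrDl mul1r trunc_expD IH exprD expr1.
Qed.

End ExponentialSeries.

Section EulerianSeries.
Variables (R : realType) (p : R) (A : nat -> {poly R}).
Hypotheses (p0 : p != 0) (p1 : 1 - p != 0) (hA : eulerian_polynomials A).

(** The coefficients of the Eulerian series at t = p, with x replaced by x / q;
after this rescaling e^{(p - 1) x} becomes e^{-x}. *)
Definition eulerian_coef (i : nat) : R :=
  (i`!%:R)^-1 * (A i).[p] / (1 - p) ^+ i.

Lemma eulerian_coef0 : eulerian_coef 0 = 1.
Proof.
have [A0 _] := (eulerian_polynomialsP A).1 hA.
by rewrite /eulerian_coef A0 hornerC fact0 invr1 !mul1r.
Qed.

(** With x rescaled, the defining equation of the Eulerian polynomials reads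
(p - e^{-x}) a = p - 1; multiply it by - e^x. *)
Lemma trunc_eulerian n :
  trunc n eulerian_coef * (1 - p *: trunc n (exp_coeff (1 : R)))
  = (1 - p) *: trunc n (exp_coeff (1 : R)).
Proof.
set a := trunc n eulerian_coef; set e := trunc n _.
have aE : (p%:A - trunc n (exp_coeff (-1 : R))) * a = (p - 1)%:A.
  rewrite -!trunc_cst -[- trunc _ _]scaleN1r -truncZ -truncD -truncM.
  apply: eq_trunc => i; have /(congr1 (fun u => u.[p] / (1 - p) ^+ i)) := hA i.
  rewrite {1}/series_mul horner_sum mulr_suml => Ei.
  transitivity ((series_cst ('X - 1) i).[p] / (1 - p) ^+ i); last first.
    case: i {Ei} => [|i] /=; first by rewrite !hornerE invr1 mulr1.
    by rewrite horner0 mul0r.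
  rewrite -Ei; apply: eq_bigr => j _.
  have -> : (1 - p) ^+ i = (1 - p) ^+ j * (1 - p) ^+ (i - j).
    by rewrite -exprD subnKC ?leq_ord.
  rewrite hornerM /eulerian_coef hornerZ invfM mulrACA; congr (_ * _).
  rewrite hornerD hornerN mulrBl mulN1r.
  congr (_ - _).
    case: (val j) => [|j'] /=; first by rewrite hornerX invr1 mulr1.
    by rewrite horner0 mul0r.
  rewrite /series_exp exp_coeffE hornerZ -mulrA; congr (_ * _).
  rewrite horner_exp !hornerE -exprVn -exprMn; congr (_ ^+ _).
  by rewrite -opprB mulNr mulfV.
have E1 : trunc n (exp_coeff (-1 : R)) * e = 1.
  by rewrite -trunc_expD addNr trunc_exp0.
rewrite -(opprB p 1) scaleNr -[(p - 1) *: e]mulr_algl -aE.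
have -> : - ((p%:A - trunc n (exp_coeff (-1 : R))) * a * e) =
  a * (trunc n (exp_coeff (-1 : R)) * e - p%:A * e) by ring.
by rewrite E1 mulr_algl.
Qed.

(** The value 0 at index 0 is a convention of the generating series: the formula
for Ftilde does not vanish at j = 0. *)
Definition Ftilde_coef (k i : nat) : R :=
  if i is 0 then 0 else Ftilde A p k i / i`!%:R.

(** The two factors are the Eulerian series without its constant term and
(p e^x)^-k - 1.  The first summand in the bracket of Ftilde_j comes from the
constant term p^-k - 1 of the second factor, the term of index i from its
coefficient of order i, and i = j is missing because the first factor has no
constant term. *)
Lemma trunc_Ftilde n k :
  trunc n (Ftilde_coef k) = (trunc n eulerian_coef - 1) *
    ((p ^+ k)^-1 *: trunc n (exp_coeff (- k%:R : R)) - 1).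
Proof.
pose a i := if i is 0 then 0 else eulerian_coef i.
have -> : trunc n eulerian_coef - 1 = trunc n a.
  rewrite -truncB1.
  by apply: eq_trunc => -[|i] /=; rewrite ?eulerian_coef0 ?subrr// subr0.
rewrite -truncZ -truncB1 mulrC -truncM; apply: eq_trunc => -[|j].
  by rewrite /series_mul big_ord1 mulr0.
rewrite /series_mul big_ord_recl big_ord_recr/= subnn mulr0 addr0 subn0.
rewrite /Ftilde big_add1/= big_mkord.
have pk : p ^+ k != 0 by rewrite expf_neq0.
have qj i : (1 - p) ^+ i != 0 by rewrite expf_neq0.
have f0 i : i`!%:R != 0 :> R by rewrite factr_neq0.
rewrite mulrDr mulrDl; congr (_ + _).
  rewrite exp_coeffE fact0 expr0 /eulerian_coef.
  by field; rewrite pk f0 qj.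
rewrite mulr_sumr mulr_suml; apply: eq_bigr => i _.
rewrite /bump/= add1n subr0.
have lt_ij : (i < j)%N by [].
have := @binr_fact R j.+1 i.+1 (ltnW (lt_ij : (i.+1 < j.+1)%N)).
have : (1 - p) ^+ j.+1 = (1 - p) ^+ i.+1 * (1 - p) ^+ (j.+1 - i.+1).
  by rewrite -exprD subnKC// ltnW.
case: (j.+1 - i.+1)%N (subn_eq0 j.+1 i.+1) => [|m _ -> <-].
  by rewrite eqxx ltnS leqNgt lt_ij.
rewrite /a /eulerian_coef exp_coeffE; set P := (A m.+1).[p].
have -> : (- k%:R) ^+ i.+1 = (-1) ^+ i.+1 * k%:R ^+ i.+1 :> R.
  by rewrite -exprMn mulN1r.
rewrite (exprMn i.+1 k%:R).
have := (qj i.+1, qj m.+1, f0 i.+1, f0 m.+1, f0 j.+1).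
move: pk {qj f0}; move: (p ^+ k) ((1 - p) ^+ i.+1) ((1 - p) ^+ m.+1).
move=> x y z x0 [[[[y0 z0] fi0] fm0] fj0].
by field; rewrite x0 y0 z0 fi0 fm0 fj0.
Qed.

End EulerianSeries.

Section GeneratingFunction.
Variables (R : realType) (p : R) (A : nat -> {poly R}) (k n : nat).
Hypotheses (p0 : p != 0) (p1 : 1 - p != 0) (hA : eulerian_polynomials A).

Local Notation E := (trunc n (exp_coeff (1 : R))).

(** One more run multiplies the generating series by (1 - F)^-1: u stands for the
fresh states after c runs, v for the completion of the c-th run, and the left
factor (p e^t)^k u for the completion of the next one. *)
Lemma run_renewal_equation (u v : tseries R n) :
  u = v + \sum_(l < k) (1 - p) *: E * (p *: E) ^+ l * u ->
  (p *: E) ^+ k * u * (1 - trunc n (Ftilde_coef p A k)) = v.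
Proof.
rewrite -mulr_suml -mulr_sumr (trunc_Ftilde p0 p1 hA).
have := trunc_eulerian p1 hA n; set a := trunc n (eulerian_coef _ _) => aE.
set b := p ^- k *: _; set e := p *: E in aE *.
(* b is the series of (p e^t)^-k. *)
have bE : b * e ^+ k = 1.
  rewrite /b /e exprZn -scalerAl -scalerAr scalerA mulVf ?expf_neq0// scale1r.
  by rewrite -[E ^+ k]trunc_expX mulr1 -trunc_expD addNr trunc_exp0.
set S := \sum_(l < k) e ^+ l; have SE : (1 - e) * S = 1 - e ^+ k.
  by rewrite -[RHS]opprB subrX1 -mulNr opprB.
rewrite -aE => uE; have {uE} vE : v = u - a * (1 - e) * S * u.
  by rewrite {1}uE addrK.
have -> : e ^+ k * u * (1 - (a - 1) * (b - 1)) =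
   u * (e ^+ k + (a - 1) * e ^+ k - (a - 1) * (b * e ^+ k)) by ring.
rewrite bE vE -(mulrA a) SE; ring.
Qed.

(** The recursion gives Y r * (1 - F) ^+ r = 1, and the inverse of the power is
the negative binomial series. *)
Lemma negative_binomial_series (r : nat) (Y : nat -> tseries R n) :
  Y 0%N = 1 ->
  (forall c, Y c.+1 * (1 - trunc n (Ftilde_coef p A k)) = Y c) ->
  tcoef n (Y r) =
  \sum_(m : {ffun 'I_n -> 'I_n.+1} | weighted_size m == n)
    ((r + tuple_size m - 1) ^_ (tuple_size m))%:R *
    \prod_(i < n) (((m i)`!)%:R^-1 * (Ftilde A p k i.+1 / i.+1`!%:R) ^+ m i).
Proof.
move=> Y0 YS; rewrite -(@tcoef_negative_binomial _ _ _ (Ftilde_coef p A k))//.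
set u := trunc _ _ in YS *; congr (tcoef n _).
have u0 : u ^+ n.+1 = 0 by apply: trunc_nilpotent.
have Yr : Y r * (1 - u) ^+ r = 1.
  by elim: r => [|r IH]; rewrite ?mulr1// exprS mulrA YS.
set S := RHS; transitivity (S * (Y r * (1 - u) ^+ r)); last by rewrite Yr mulr1.
by rewrite mulrCA (negative_binomial_inverse r u0) mulr1.
Qed.

End GeneratingFunction.
(** * Moments of sequences *)

Section Moments.
Variable R : realType.
Implicit Types (a mu : nat -> R) (c : R).

(** mu i is the i-th moment of a divided by i!, that is, the coefficient of t^i
in the formal series sum_m a m e^{mt}. *)
Definition has_moments a mu : Prop := forall i,
  series (fun m => a m * exp_coeff m%:R i) @ \oo --> mu i.

Definition delay a (m : nat) : R := if m is m'.+1 then a m' else 0.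

Lemma has_moments_unique a mu1 mu2 :
  has_moments a mu1 -> has_moments a mu2 -> mu1 =1 mu2.
Proof. by move=> h1 h2 i; exact: (cvg_unique _ (h1 i) (h2 i)). Qed.

Lemma eq_has_moments a1 a2 mu1 mu2 : a1 =1 a2 -> mu1 =1 mu2 ->
  has_moments a1 mu1 -> has_moments a2 mu2.
Proof. by move=> /funext-> /funext->. Qed.

Lemma has_momentsD a1 a2 mu1 mu2 : has_moments a1 mu1 -> has_moments a2 mu2 ->
  has_moments (fun m => a1 m + a2 m) (fun i => mu1 i + mu2 i).
Proof.
move=> h1 h2 i; rewrite (_ : series _ = series (fun m => a1 m * exp_coeff m%:R i)
  \+ series (fun m => a2 m * exp_coeff m%:R i)); first exact: cvgD.
by apply/funext => N; rewrite /series/= -big_split; apply: eq_bigr => m _;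
  rewrite mulrDl.
Qed.

Lemma has_momentsZ c a mu : has_moments a mu ->
  has_moments (fun m => c * a m) (fun i => c * mu i).
Proof.
move=> h i; rewrite (_ : series _ = fun N => c * series
  (fun m => a m * exp_coeff m%:R i) N); first exact: cvgMl_tmp.
by apply/funext => N; rewrite /series/= mulr_sumr; apply: eq_bigr => m _;
  rewrite mulrA.
Qed.

Lemma has_moments0 : has_moments (fun=> 0) (fun=> 0).
Proof.
move=> i; rewrite (_ : series _ = fun=> 0); first exact: cvg_cst.
by apply/funext => N; rewrite /series/= big1// => m _; rewrite mul0r.
Qed.

Lemma has_moments_sum (I : Type) (t : seq I) (a mu : I -> nat -> R) :
  (forall i, has_moments (a i) (mu i)) ->
  has_moments (fun m => \sum_(i <- t) a i m) (fun j => \sum_(i <- t) mu i j).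
Proof.
move=> h; elim: t => [|i t IH].
  by apply: eq_has_moments has_moments0 => m; rewrite big_nil.
by apply: eq_has_moments (has_momentsD (h i) IH) => m; rewrite big_cons.
Qed.

Lemma has_moments_cst c : has_moments (series_cst c) (series_cst c).
Proof.
move=> i; rewrite -cvg_shiftS (_ : [sequence _]_n = fun=> series_cst c i).
  exact: cvg_cst.
apply/funext => N; rewrite /series/= big_nat_recl//= big1 ?addr0; last first.
  by move=> m _; rewrite mul0r.
case: i => [|i]; rewrite /exp_coeff/= ?fact0 ?divr1 ?mulr1//.
by rewrite expr0n/= mul0r mulr0.
Qed.

(** Replacing m by m + 1 multiplies sum_m a m e^{mt} by e^t. *)
Lemma has_moments_delay a mu : has_moments a mu ->
  has_moments (delay a) (series_mul (exp_coeff 1) mu).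
Proof.
move=> h i; rewrite -cvg_shiftS.
rewrite (_ : [sequence _]_n = fun N => \sum_(j < i.+1) exp_coeff 1 j *
   series (fun m => a m * exp_coeff m%:R (i - j)%N) N).
  apply: (cvg_big (@add_continuous R)) => j _.
  exact: (cvgMl_tmp (h _)).
apply/funext => N /=; rewrite /series/= big_nat_recl//= mul0r add0r.
under [RHS]eq_bigr => j _ do rewrite mulr_sumr.
rewrite exchange_big/=; apply: eq_bigr => m _.
rewrite -[m.+1]add1n natrD -series_mul_exp mulr_sumr; apply: eq_bigr => j _.
by rewrite mulrCA.
Qed.

(** An exponential moment dominates all moments, as x^i / i! <= e^x for x >= 0. *)
Lemma has_moments_bounded a y B : 0 < y -> (forall m, 0 <= a m) ->
  (forall N, \sum_(m < N) a m * expR y ^+ m <= B) ->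
  exists mu, has_moments a mu.
Proof.
move=> y0 a0 aB.
exists (fun i => limn (series (fun m => a m * exp_coeff m%:R i))) => i.
apply/nondecreasing_is_cvgn.
  move=> N M NM; rewrite /series/= (big_cat_nat _ NM)//= lerDl.
  by apply: sumr_ge0 => m _; rewrite mulr_ge0// divr_ge0// exprn_ge0.
exists (B / y ^+ i) => _ [N _ <-]; rewrite ler_pdivlMr ?exprn_gt0//.
apply: le_trans (aB N); rewrite /series/= big_mkord mulr_suml ler_sum// => m _.
rewrite -mulrA ler_wpM2l// /exp_coeff/= mulrAC -exprMn -expRM_natl.
have my0 : 0 <= m%:R * y by rewrite mulr_ge0// ltW.
case: i => [|i]; last first.
  by apply: le_trans (expR_ge1Dxn i my0); rewrite lerDr.
by rewrite fact0 divr1 expr0 (le_trans _ (expR_ge1Dx _))// lerDl.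
Qed.

End Moments.
(** * The renewal equation for the fresh states *)

Section IteratedDelay.
Variable R : realType.
Implicit Types (a mu : nat -> R).

Lemma iter_delayE l a m :
  iter l (@delay R) a m = if (l <= m)%N then a (m - l)%N else 0.
Proof.
elim: l m => [|l IH] m; first by rewrite subn0.
by case: m => [|m] //=; rewrite IH ltnS subSS.
Qed.

Lemma has_moments_iter_delay l a mu : has_moments a mu ->
  has_moments (iter l (@delay R) a) (iter l (series_mul (exp_coeff 1)) mu).
Proof. by move=> h; elim: l => //= l IH; exact: has_moments_delay. Qed.

Lemma trunc_iter_exp n l mu : trunc n (iter l (series_mul (exp_coeff 1)) mu) =
  trunc n (exp_coeff (1 : R)) ^+ l * trunc n mu.
Proof.
by elim: l => [|l IH] /=; rewrite ?mul1r// truncM IH [_ ^+ l.+1]exprS mulrA.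
Qed.

Lemma sum_delay_le a z N : 0 <= z -> (forall m, 0 <= a m) ->
  \sum_(m < N) delay a m * z ^+ m <= z * \sum_(m < N) a m * z ^+ m.
Proof.
move=> z0 a0; case: N => [|N]; first by rewrite !big_ord0 mulr0.
rewrite big_ord_recl/= mul0r add0r big_ord_recr/= mulrDr mulr_sumr.
rewrite (eq_bigr (fun m : 'I_N => z * (a m * z ^+ m))).
  by rewrite lerDl !mulr_ge0// exprn_ge0.
by move=> m _; rewrite /bump/= add1n exprS mulrCA.
Qed.

Lemma sum_iter_delay_le l a z N : 0 <= z -> (forall m, 0 <= a m) ->
  \sum_(m < N) iter l (@delay R) a m * z ^+ m
  <= z ^+ l * \sum_(m < N) a m * z ^+ m.
Proof.
move=> z0 a0; elim: l => [|l IH]; first by rewrite expr0 mul1r.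
have ia0 m : 0 <= iter l (@delay R) a m by rewrite iter_delayE; case: ifP.
apply: le_trans (sum_delay_le _ z0 ia0) _.
by rewrite exprS -mulrA ler_wpM2l.
Qed.

End IteratedDelay.

Section Renewal.
Variables (R : realType) (p : R) (k : nat).
Hypotheses (p0 : 0 < p) (p1 : p < 1).

(** At t = 0 the sum is the probability 1 - p ^+ k that k given trials contain a
failure; it stays below 1 nearby by continuity. *)
Lemma escape_rate : exists2 t : R, 0 < t &
  \sum_(l < k) (1 - p) * p ^+ l * expR t ^+ l.+1 < 1.
Proof.
pose theta (t : R) := \sum_(l < k) (1 - p) * p ^+ l * expR t ^+ l.+1.
have theta0 : theta 0 = 1 - p ^+ k.
  rewrite /theta expR0 -[1 - p ^+ k]opprB subrX1 -mulNr opprB mulr_sumr.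
  by apply: eq_bigr => l _; rewrite expr1n mulr1.
have ctheta : {for 0, continuous theta}.
  apply: (cvg_big (@add_continuous R)) => l _; apply: cvgMl_tmp.
  apply: (@continuous_comp _ _ _ (@expR R) (fun x => x ^+ l.+1)).
    exact: continuous_expR.
  exact: exprn_continuous.
have : \forall t \near 0^'+, theta t < 1.
  apply: (cvgr_lt (theta 0)); first exact: cvg_at_right_filter.
  by rewrite theta0 ltrBlDr ltrDl exprn_gt0.
move=> theta1; have [t []] : exists t, 0 < t /\ theta t < 1; last by exists t.
near (0 : R)^'+ => t; exists t; split; last by near: t.
by near: t; exact: nbhs_right_gt.
Unshelve. all: by end_near. Qed.

(** b c m plays the role of the probability of a fresh state after m trials and
c runs, and y c m that of the completion of the c-th run at trial m. *)
Variables b y : nat -> nat -> R.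
Hypotheses (b_ge0 : forall c m, 0 <= b c m).
Hypothesis y_0 : y 0%N =1 series_cst 1.
Hypothesis y_S : forall c m, y c.+1 m = p ^+ k * iter k (@delay R) (b c) m.
Hypothesis bE : forall c m, b c m =
  y c m + \sum_(l < k) (1 - p) * p ^+ l * iter l.+1 (@delay R) (b c) m.

(** Summing the renewal equation against e^{tm} bounds a partial sum U of b c by
the corresponding bound for y c plus theta U, where theta < 1 by [escape_rate];
the bound for y c.+1 then follows from the one for b c. *)
Lemma exponential_moments : exists2 t : R, 0 < t &
  forall c, exists B, forall N, \sum_(m < N) b c m * expR t ^+ m <= B.
Proof.
have [t t0 theta1] := escape_rate; exists t => //.
set theta := \sum_(l < k) _ in theta1; pose z := expR t.
have z0 : 0 <= z by exact: expR_ge0.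
have bound c B : (forall N, \sum_(m < N) y c m * z ^+ m <= B) ->
    forall N, \sum_(m < N) b c m * z ^+ m <= B / (1 - theta).
  move=> yB N; rewrite ler_pdivlMr ?subr_gt0// mulrBr mulr1 lerBlDr.
  set U := \sum_(m < N) _; have UE : U = \sum_(m < N) y c m * z ^+ m +
      \sum_(l < k) (1 - p) * p ^+ l *
        \sum_(m < N) iter l.+1 (@delay R) (b c) m * z ^+ m.
    under [X in _ + X]eq_bigr => l _ do rewrite mulr_sumr.
    rewrite exchange_big -big_split; apply: eq_bigr => m _ /=.
    rewrite {1}bE mulrDl; congr (_ + _); rewrite mulr_suml.
    by apply: eq_bigr => l _; rewrite mulrA.
  rewrite {1}UE lerD ?yB// [leRHS]mulr_sumr ler_sum// => l _.
  have c0 : 0 <= (1 - p) * p ^+ l by rewrite mulr_ge0 ?subr_ge0 ?exprn_ge0 ?ltW.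
  rewrite mulrCA (ler_wpM2l c0)// mulrC; exact: sum_iter_delay_le.
elim=> [|c [B HB]].
  exists (1 / (1 - theta)); apply: bound => -[|N]; first by rewrite big_ord0.
  rewrite big_ord_recl y_0/= mulr1 big1 ?addr0// => m _.
  by rewrite y_0 mul0r.
exists ((p ^+ k * (z ^+ k * B)) / (1 - theta)); apply: bound => N.
under eq_bigr => m _ do rewrite y_S -mulrA.
rewrite -mulr_sumr (ler_wpM2l (exprn_ge0 k (ltW p0)))//.
apply: le_trans (sum_iter_delay_le k N z0 (b_ge0 c)) _.
by rewrite ler_wpM2l ?exprn_ge0.
Qed.

(** Summation against e^{mt} turns the two recursions into the hypothesis of
[run_renewal_equation]; uniqueness of the moments makes the identities between
sequences identities between series of moments. *)
Lemma run_moments (A : nat -> {poly R}) (hA : eulerian_polynomials A) (r : nat) :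
  has_moments (y r) (fun n =>
  \sum_(m : {ffun 'I_n -> 'I_n.+1} | weighted_size m == n)
    ((r + tuple_size m - 1) ^_ (tuple_size m))%:R *
    \prod_(i < n) (((m i)`!)%:R^-1 * (Ftilde A p k i.+1 / i.+1`!%:R) ^+ m i)).
Proof.
have [t t0 tb] := exponential_moments.
have mu_ex c : exists mu, has_moments (b c) mu.
  by have [B HB] := tb c; exact: has_moments_bounded t0 (b_ge0 c) HB.
pose mu c := projT1 (cid (mu_ex c)).
have hmu c : has_moments (b c) (mu c) := projT2 (cid (mu_ex c)).
pose E l := iter l (@series_mul R (exp_coeff 1)).
pose nu c := if c is c'.+1 then fun i => p ^+ k * E k (mu c') i else series_cst 1.
have hnu c : has_moments (y c) (nu c).
  case: c => [|c].
    apply: (eq_has_moments (fun m => esym (y_0 m)) (fun=> erefl)).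
    exact: has_moments_cst.
  apply: (eq_has_moments (fun m => esym (y_S c m)) (fun=> erefl)).
  by apply: has_momentsZ; exact: has_moments_iter_delay.
have muE c : mu c =1 fun i =>
    nu c i + \sum_(l < k) (1 - p) * p ^+ l * E l.+1 (mu c) i.
  apply: (has_moments_unique (hmu c)).
  apply: (eq_has_moments (fun m => esym (bE c m)) (fun=> erefl)).
  apply: has_momentsD => //; apply: has_moments_sum => l.
  by apply: has_momentsZ; exact: has_moments_iter_delay.
apply: (eq_has_moments (fun=> erefl) _ (hnu r)) => n; pose Y c := trunc n (nu c).
have truncS (F : nat -> nat -> R) : trunc n (fun i => \sum_(l < k) F l i) =
    \sum_(l < k) trunc n (F l).
  elim: k => [|l IH]; last first.
    rewrite big_ord_recr/= -IH -truncD.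
    by apply: eq_trunc => i; rewrite big_ord_recr.
  rewrite big_ord0 (@eq_trunc _ _ _ (series_cst 0)) ?trunc_cst ?scale0r//.
  by case=> [|i]; rewrite big_ord0.
rewrite -(tcoef_trunc (nu r) (leqnn n)) -/(Y r).
apply: (@negative_binomial_series _ p) => [|c].
  by rewrite /Y trunc_cst scale1r.
have q0 : 1 - p != 0 by rewrite subr_eq0 eq_sym lt_eqF.
rewrite -(@run_renewal_equation _ p A k n (lt0r_neq0 p0) q0 hA
  (trunc n (mu c)) (Y c)).
  congr (_ * _); rewrite /Y /nu truncZ trunc_iter_exp exprZn.
  by rewrite -scalerAl.
rewrite {1}(eq_trunc _ (muE c)) truncD; congr (_ + _).
rewrite (truncS (fun l i => (1 - p) * p ^+ l * E l.+1 (mu c) i)).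
apply: eq_bigr => l _; rewrite truncZ trunc_iter_exp [_ ^+ l.+1]exprS exprZn.
set e := trunc n (exp_coeff 1).
by rewrite -(scalerAl (1 - p) e) -(scalerAr (p ^+ l) e) scalerA -scalerAl.
Qed.

End Renewal.
(** * Runs in a deterministic sequence of outcomes *)

Section RunDynamics.
Variable k : nat.
Hypothesis k_gt0 : (0 < k)%N.
Implicit Types (x y : nat -> bool) (m r c l : nat).

(** Trials are numbered from 1, so that x m is the outcome of trial m.+1: the
predicate says that the r-th run is completed at that trial. *)
Definition run_completed r x m : bool :=
  [&& (0 < r)%N, x m & run_state k x m == (r.-1, k.-1)].

Lemma eq_run_state x y m : (forall i, (i < m)%N -> x i = y i) ->
  run_state k x m = run_state k y m.
Proof.
elim: m => //= m IH xy; rewrite IH ?xy// => i lt_im.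
by rewrite xy// ltnW.
Qed.

Lemma run_state_lt x m : ((run_state k x m).2 < k)%N.
Proof.
elim: m => //= m; case: (run_state k x m) => c l /= lt_lk.
by case: (x m) => //; case: eqP => [//|/eqP]; rewrite /= ltn_neqAle => ->.
Qed.

Lemma run_state_extend x m c l : (l.+1 < k)%N ->
  (run_state k x m.+1 == (c, l.+1)) = (run_state k x m == (c, l)) && x m.
Proof.
move=> lt_lk /=; case: (run_state k x m) => c' l'.
case: (x m); rewrite ?andbT ?andbF ?xpair_eqE ?andbF//.
have [l'k|_] := eqVneq l'.+1 k; rewrite !xpair_eqE ?andbF ?eqSS//.
by case: (l' =P l) => [l'l|_]; rewrite ?andbF//; rewrite -l'k l'l ltnn in lt_lk.
Qed.

Lemma run_state_restart x m c : (run_state k x m.+1 == (c, 0%N)) =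
  run_completed c x m || (~~ x m && ((run_state k x m).1 == c)).
Proof.
rewrite /run_completed /=; case: (run_state k x m) => c' l' /=.
case: (x m) => /=; rewrite ?andbF ?orbF ?xpair_eqE ?andbT//.
have -> : (l' == k.-1) = (l'.+1 == k) by rewrite -[in RHS](prednK k_gt0) eqSS.
case: ifP => _; rewrite xpair_eqE ?andbT ?andbF//.
by case: c => [|c] //=; rewrite eqSS.
Qed.

Lemma run_count_step x m :
  run_count k x m.+1 = (run_count k x m + run_completed (run_count k x m).+1 x m)%N.
Proof.
rewrite /run_completed /run_count /=; case: (run_state k x m) => c l /=.
rewrite xpair_eqE eqxx /= -[in RHS](eqSS l) prednK//.
by case: (x m) => /=; rewrite ?addn0//; case: eqP => _; rewrite ?addn1 ?addn0.
Qed.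

Lemma run_count_homo x : {homo run_count k x : m n / (m <= n)%N}.
Proof.
by apply: homo_leq (leqnn) leq_trans _ => m; rewrite run_count_step leq_addr.
Qed.

(** The count is r after m.+1 trials and, being monotone, at most r.-1 before. *)
Lemma waiting_time_completed (R : realType) r x m : run_completed r x m ->
  waiting_time R k r x = (m.+1%:R)%:E.
Proof.
move=> rm; have [r_gt0 _ /eqP sm] := and3P rm.
have cm : run_count k x m = r.-1 by rewrite /run_count sm.
apply/eqP; rewrite eq_le; apply/andP; split.
  apply: ereal_inf_lbound; exists m.+1 => //=.
  by rewrite run_count_step cm prednK// rm addn1 prednK.
apply: le_ereal_inf_tmp => _ [m' /= cm' <-]; rewrite lee_fin ler_nat ltnNge.
apply/negP => /(run_count_homo x); rewrite cm cm'.
by rewrite leqNgt prednK ?leqnn.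
Qed.

(** The count starts at 0 < r and increases by at most one at each trial, so it
can reach r only through the completion of the r-th run. *)
Lemma waiting_time_infinite (R : realType) r x : (0 < r)%N ->
  (forall m, ~~ run_completed r x m) -> waiting_time R k r x = +oo%E.
Proof.
move=> r_gt0 Nr; rewrite /waiting_time (_ : [set _ | _ in _] = set0) ?ereal_inf0//.
apply/seteqP; split=> // _ [m /= cm _]; elim: m cm => [|m IH].
  by move=> r0; rewrite -r0 in r_gt0.
rewrite run_count_step; case: (boolP (run_completed _ _ _)) => [rm|_].
  by rewrite addn1 => cm; move: rm; rewrite cm (negPf (Nr m)).
by rewrite addn0.
Qed.

End RunDynamics.
(** * Independence of the past and the next trial *)

Section BernoulliTrials.
Context (R : realType) (d : measure_display) (T : measurableType d)
  (P : probability T R) (p : R) (X : nat -> {RV P >-> bool}).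
Hypotheses (p0 : 0 < p) (p1 : p < 1) (hX : bernoulli_trials p X).

Local Notation path w := (fun i => X i w).

Let w01 b : 0 <= bernoulli_pmf p b.
Proof. by apply: bernoulli_pmf_ge0; rewrite !ltW. Qed.

Lemma measurable_trial i b : measurable (X i @^-1` [set b]).
Proof. exact: measurable_funPTI. Qed.

Lemma trial_prob i b : P (X i @^-1` [set b]) = (bernoulli_pmf p b)%:E.
Proof.
rewrite -[LHS]/(distribution P (X i) [set b]) hX.1 /bernoulli_prob.
by rewrite !ltW// fsbig_set1.
Qed.

Definition determined_before (m : nat) (phi : (nat -> bool) -> bool) : Prop :=
  forall x y, (forall i, (i < m)%N -> x i = y i) -> phi x = phi y.

(** Induction on m, conditioning on the last outcome of the prefix: fixing it to
b turns phi into a function psi b of one trial less, and trial m joins the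
finite family J of later trials; hence J has to be arbitrary.  The product rule
for J itself is the independence hypothesis. *)
Lemma prefix_independent m phi : determined_before m phi ->
  measurable [set w | phi (path w)] /\
  forall (J : {fset nat}) (z : nat -> bool), (forall i, i \in J -> (m <= i)%N) ->
  P ([set w | phi (path w)] `&` \bigcap_(i in [set` J]) X i @^-1` [set z i]) =
  (P [set w | phi (path w)] * (\prod_(i <- J) bernoulli_pmf p (z i))%:E)%E.
Proof.
have capP (J : {fset nat}) (z : nat -> bool) :
    P (\bigcap_(i in [set` J]) X i @^-1` [set z i]) =
    (\prod_(i <- J) bernoulli_pmf p (z i))%:E.
  rewrite (hX.2 J (fun i => [set z i]))// -prodEFin.
  by apply: eq_bigr => i _; exact: trial_prob.
have mcap (J : {fset nat}) (z : nat -> bool) :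
    measurable (\bigcap_(i in [set` J]) X i @^-1` [set z i]).
  by apply: fin_bigcap_measurable => // i _; exact: measurable_trial.
elim: m phi => [|m IH] phi phim.
  have -> : [set w | phi (path w)] = if phi xpredT then setT else set0.
    by apply/seteqP; split=> w /=; rewrite (phim _ xpredT)//; case: ifP.
  split=> [|J z _]; first by case: ifP.
  case: ifP => _; first by rewrite setTI probability_setT mul1e capP.
  by rewrite set0I measure0 mul0e.
pose psi b x := phi (fun i => if i == m then b else x i).
have psim b : determined_before m (psi b).
  move=> x y xy; apply: phim => i; rewrite ltnS leq_eqVlt.
  by case: eqP => //= _; exact: xy.
have psiX b w : X m w = b -> psi b (path w) = phi (path w).
  by move=> Xm; apply: phim => i _; case: eqP => // ->.
have phiE : [set w | phi (path w)] =
    ([set w | psi true (path w)] `&` X m @^-1` [set true]) `|`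
    ([set w | psi false (path w)] `&` X m @^-1` [set false]).
  apply/seteqP; split=> w /=; last by case=> -[psiw Xm]; rewrite -(psiX _ _ Xm).
  by move=> phiw; case Xm : (X m w); [left|right]; split=> //; rewrite psiX.
have mpsi b : measurable [set w | psi b (path w)] by case: (IH _ (psim b)).
split.
  by rewrite phiE; apply: measurableU; apply: measurableI => //;
    exact: measurable_trial.
have PJ (J : {fset nat}) (z : nat -> bool) : (forall i, i \in J -> (m < i)%N) ->
  P ([set w | phi (path w)] `&` \bigcap_(i in [set` J]) X i @^-1` [set z i]) =
  ((P [set w | psi true (path w)] * (bernoulli_pmf p true)%:E +
    P [set w | psi false (path w)] * (bernoulli_pmf p false)%:E) *
   (\prod_(i <- J) bernoulli_pmf p (z i))%:E)%E.
  move=> Jm; have mJ : m \notin J by apply/negP => /Jm; rewrite ltnn.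
  pose zz b i := if i == m then b else z i.
  have capE b : X m @^-1` [set b] `&` \bigcap_(i in [set` J]) X i @^-1` [set z i]
      = \bigcap_(i in [set` (m |` J)%fset]) X i @^-1` [set zz b i].
    apply/seteqP; split=> w /=.
      move=> [Xm XJ] i /=; rewrite in_fset1U /zz; case: eqP => [-> //|_ /= iJ].
      exact: XJ.
    move=> Xw; split; first by have := Xw m; rewrite /= /zz fset1U1 eqxx; exact.
    move=> i /= iJ; have := Xw i; rewrite /= /zz fset1Ur//.
    by have [im|_] := eqVneq i m; [rewrite -im iJ in mJ|exact].
  have PE b : P ([set w | psi b (path w)] `&` (X m @^-1` [set b] `&`
      \bigcap_(i in [set` J]) X i @^-1` [set z i])) =
      (P [set w | psi b (path w)] * (bernoulli_pmf p b)%:E *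
      (\prod_(i <- J) bernoulli_pmf p (z i))%:E)%E.
    rewrite capE; case: (IH _ (psim b)) => _ ->; last first.
      by move=> i; rewrite in_fset1U => /orP[/eqP->//|/Jm /ltnW].
    rewrite big_fsetU1//= {1}/zz eqxx EFinM muleA; congr (_ * (_)%:E)%E.
    rewrite big_seq [RHS]big_seq; apply: eq_bigr => i iJ; rewrite /zz.
    by case: eqP => // im; rewrite -im iJ in mJ.
  rewrite phiE setIUl -!setIA measureU.
  - rewrite ge0_muleDl ?mule_ge0 ?lee_fin ?w01//.
    by congr (_ + _)%E; exact: PE.
  - by apply: measurableI => //; apply: measurableI => //; exact: measurable_trial.
  - by apply: measurableI => //; apply: measurableI => //; exact: measurable_trial.
  - by apply/seteqP; split=> w // [[_ [/= -> _]]] [_ []].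
move=> J z Jm; rewrite PJ//; congr (_ * _)%E.
have := PJ fset0 z; rewrite set_fset0 bigcap_set0 setIT big_seq_fset0 mule1.
by move=> ->.
Qed.

Lemma prefix_event_measurable m phi : determined_before m phi ->
  measurable [set w | phi (path w)].
Proof. by case/prefix_independent. Qed.

Lemma prefix_trial_prob m phi b : determined_before m phi ->
  P [set w | phi (path w) && (X m w == b)] =
  (P [set w | phi (path w)] * (bernoulli_pmf p b)%:E)%E.
Proof.
move=> /prefix_independent[_ /(_ [fset m]%fset (fun=> b))] H.
rewrite big_seq_fset1 in H; rewrite -H; last by move=> i; rewrite inE => /eqP->.
congr (P _); apply/seteqP; split=> w /=.
  by move=> /andP[phiw /eqP Xm]; split=> // i /=; rewrite inE => /eqP->.
by move=> [-> /(_ m)]; rewrite /= inE eqxx => ->//=; rewrite eqxx.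
Qed.

End BernoulliTrials.
(** * The law of the waiting time *)

Section RunProbabilities.
Context (R : realType) (d : measure_display) (T : measurableType d)
  (P : probability T R) (p : R) (X : nat -> {RV P >-> bool}) (k : nat).
Hypotheses (p0 : 0 < p) (p1 : p < 1) (hX : bernoulli_trials p X).
Hypothesis k_gt0 : (0 < k)%N.

Local Notation path w := (fun i => X i w).

Definition prefix_prob (phi : (nat -> bool) -> bool) : R :=
  fine (P [set w | phi (path w)]).

Lemma prefix_prob_ge0 phi : 0 <= prefix_prob phi.
Proof. by rewrite fine_ge0// measure_ge0. Qed.

Lemma eq_prefix_prob phi psi : phi =1 psi -> prefix_prob phi = prefix_prob psi.
Proof. by move=> /funext->. Qed.

Lemma prefix_prob_fin m phi : determined_before m phi ->
  P [set w | phi (path w)] = (prefix_prob phi)%:E.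
Proof.
move=> phim; rewrite /prefix_prob fineK// fin_num_measure//.
exact: (prefix_event_measurable p0 p1 hX phim).
Qed.

Lemma prefix_prob0 : prefix_prob (fun=> false) = 0.
Proof.
rewrite /prefix_prob (_ : [set _ | _] = set0) ?measure0//.
by apply/seteqP; split.
Qed.

Lemma prefix_prob_trial m phi b : determined_before m phi ->
  prefix_prob (fun x => phi x && (x m == b)) =
  prefix_prob phi * bernoulli_pmf p b.
Proof.
move=> phim; rewrite /prefix_prob (prefix_trial_prob p0 p1 hX b phim).
by rewrite (prefix_prob_fin phim).
Qed.

Lemma prefix_prob_or m phi psi : determined_before m phi ->
  determined_before m psi -> (forall x, phi x -> ~~ psi x) ->
  prefix_prob (fun x => phi x || psi x) = prefix_prob phi + prefix_prob psi.
Proof.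
move=> phim psim disj; apply/EFin_inj; rewrite EFinD.
rewrite -!(@prefix_prob_fin m)//; last first.
  by move=> x y xy; rewrite (phim _ _ xy) (psim _ _ xy).
rewrite -measureU; first by congr (P _); apply/seteqP; split=> w /= /orP.
- exact: (prefix_event_measurable p0 p1 hX phim).
- exact: (prefix_event_measurable p0 p1 hX psim).
- by apply/seteqP; split=> w //= [/disj /negP].
Qed.

Lemma run_state_determined m (f : nat * nat -> bool) :
  determined_before m (fun x => f (run_state k x m)).
Proof. by move=> x y xy; rewrite (eq_run_state k xy). Qed.

(** The sequence b_c of the renewal argument. *)
Definition fresh_prob (c m : nat) : R :=
  prefix_prob (fun x => run_state k x m == (c, 0%N)).

(** The law of the c-th completion time, in the form in which the renewal
argument needs it; for c > 0 it is identified with a probability in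
[run_completed_prob].  The 0-th run is completed at time 0. *)
Definition completion_prob (c : nat) : nat -> R :=
  if c is c'.+1 then fun m => p ^+ k * iter k (@delay R) (fresh_prob c') m
  else series_cst 1.

(** A run of length l in progress is a fresh state followed by l successes. *)
Lemma run_state_prob l c m : (l < k)%N ->
  prefix_prob (fun x => run_state k x m == (c, l)) =
  p ^+ l * iter l (@delay R) (fresh_prob c) m.
Proof.
elim: l m => [|l IH] m lt_lk; first by rewrite mul1r.
case: m => [|m].
  rewrite mulr0 -prefix_prob0; apply: eq_prefix_prob => x /=.
  by rewrite xpair_eqE andbF.
rewrite (@eq_prefix_prob _ (fun x => (run_state k x m == (c, l)) && (x m == true))).
  rewrite prefix_prob_trial; last exact: run_state_determined (fun s => s == _).
  by rewrite IH ?(ltnW lt_lk)// exprS mulrC mulrA.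
by move=> x; rewrite run_state_extend// eqb_id.
Qed.

Lemma run_completed_prob r m : (0 < r)%N ->
  prefix_prob (fun x => run_completed k r x m) = completion_prob r m.+1.
Proof.
case: r => // r _; rewrite (@eq_prefix_prob _
    (fun x => (run_state k x m == (r, k.-1)) && (x m == true))); last first.
  by move=> x; rewrite eqb_id andbC.
rewrite prefix_prob_trial; last exact: run_state_determined (fun s => s == _).
rewrite run_state_prob ?prednK// /completion_prob -(prednK k_gt0) /=.
by rewrite exprS mulrC mulrA.
Qed.

Lemma run_count_prob c m :
  prefix_prob (fun x => (run_state k x m).1 == c) =
  \sum_(l < k) p ^+ l * iter l (@delay R) (fresh_prob c) m.
Proof.
rewrite (@eq_prefix_prob _ (fun x => ((run_state k x m).1 == c) &&
   ((run_state k x m).2 < k)%N)); last by move=> x; rewrite run_state_lt ?andbT.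
suff cumul j : (j <= k)%N -> prefix_prob (fun x =>
    ((run_state k x m).1 == c) && ((run_state k x m).2 < j)%N) =
    \sum_(l < j) p ^+ l * iter l (@delay R) (fresh_prob c) m by exact: cumul.
elim: j => [|j IH] lt_jk.
  rewrite big_ord0 -prefix_prob0; apply: eq_prefix_prob => x.
  by rewrite ltn0 andbF.
rewrite big_ord_recr/= -IH ?(ltnW lt_jk)// -run_state_prob// -(@prefix_prob_or m).
- apply: eq_prefix_prob => x; case: (run_state k x m) => c' l' /=.
  by rewrite xpair_eqE ltnS leq_eqVlt orbC -andb_orr.
- exact: run_state_determined (fun s => (s.1 == c) && (s.2 < j)%N).
- exact: run_state_determined (fun s => s == _).
- move=> x; case: (run_state k x m) => c' l' /= /andP[_ lt_lj].
  by rewrite xpair_eqE (ltn_eqF lt_lj) andbF.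
Qed.

(** For m > 0, either the last trial completes the c-th run, or it is a failure;
in the latter case the run that it ended had some length l < k, and
[run_state_prob] leads back to the fresh state before that run. *)
Lemma fresh_prob_renewal c m : fresh_prob c m = completion_prob c m +
  \sum_(l < k) (1 - p) * p ^+ l * iter l.+1 (@delay R) (fresh_prob c) m.
Proof.
case: m => [|m].
  rewrite big1 ?addr0; last by move=> l _; rewrite mulr0.
  case: c => [|c]; last first.
    rewrite /completion_prob -(prednK k_gt0)/= mulr0 -prefix_prob0.
    by apply: eq_prefix_prob => x /=; rewrite xpair_eqE.
  rewrite /fresh_prob /prefix_prob (_ : [set _ | _] = setT) ?probability_setT//.
  by apply/seteqP; split.
rewrite {1}/fresh_prob (eq_prefix_prob (fun x => run_state_restart k_gt0 x m c)).
have detT phi b : determined_before m phi ->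
    determined_before m.+1 (fun x => phi x && (x m == b)).
  by move=> phim x y xy; rewrite xy// (phim x y)// => i /ltnW; exact: xy.
have det_c : determined_before m (fun x => (run_state k x m).1 == c).
  exact: run_state_determined (fun s => s.1 == c).
rewrite (@prefix_prob_or m.+1); first 1 last.
- case: c {det_c} => [|c] x y xy; rewrite /run_completed//=.
  by rewrite (eq_run_state k (fun i lt_im => xy i (ltnW lt_im))) xy.
- move=> x y xy; rewrite xy//.
  by rewrite (eq_run_state k (fun i lt_im => xy i (ltnW lt_im))).
- by move=> x; rewrite /run_completed => /and3P[_ -> _].
congr (_ + _).
  case: c {det_c} => [|c]; last exact: run_completed_prob.
  by rewrite /= -prefix_prob0; exact: eq_prefix_prob.
rewrite (@eq_prefix_prob _ (fun x =>
    ((run_state k x m).1 == c) && (x m == false))); last first.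
  by move=> x; rewrite andbC eqbF_neg.
rewrite prefix_prob_trial// run_count_prob mulrC mulr_sumr.
by apply: eq_bigr => l _; rewrite mulrA.
Qed.

End RunProbabilities.
(** * The raw moments *)

Lemma eseries_moments (R : realType) (a mu : nat -> R) n : a 0%N = 0 ->
  has_moments a mu ->
  (\sum_(m <oo) (a m.+1 * m.+1%:R ^+ n)%:E = (n`!%:R * mu n)%:E)%E.
Proof.
move=> a0 /(_ n); rewrite -cvg_shiftS => amu; apply: cvg_lim => //.
rewrite (_ : (fun N => _) = EFin \o (fun N => n`!%:R *
    series (fun m => a m * exp_coeff m%:R n) N.+1)).
  by apply: cvg_EFin; [exact: nearW|exact: cvgMl_tmp].
apply/funext => N /=; rewrite sumEFin /series/= big_nat_recl//= a0 mul0r add0r.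
congr (_%:E); rewrite mulr_sumr; apply: eq_bigr => m _.
by rewrite /exp_coeff/= mulrCA [in RHS](mulrC n`!%:R) divfK ?factr_neq0.
Qed.

Theorem mainTheorem6 (R : realType) (d : measure_display) (T : measurableType d)
    (P : probability T R) (k r : nat) (hk : (1 <= k)%N) (hr : (1 <= r)%N)
    (p : R) (hp0 : 0 < p) (hp1 : p < 1)
    (X : nat -> {RV P >-> bool}) (hX : bernoulli_trials p X)
    (A : nat -> {poly R}) (hA : eulerian_polynomials A)
    (n : nat) (hn : (1 <= n)%N) :
  (\int[P]_w (waiting_time R k r (fun i => X i w) ^+ n))%E =
  (n`!%:R *
   \sum_(m : {ffun 'I_n -> 'I_n.+1} | weighted_size m == n)
     ((r + tuple_size m - 1) ^_ (tuple_size m))%N%:R *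
     \prod_(i < n) (((m i)`!)%:R^-1 * (Ftilde A p k i.+1 / (i.+1)`!%:R) ^+ m i))%:E.
Proof.
have y0 : completion_prob p X k r 0 = 0.
  by case: r hr => // r' _; rewrite /= -(prednK hk) /= mulr0.
have moments := @run_moments R p k hp0 hp1 (fresh_prob X k)
  (completion_prob p X k) (fun c m => prefix_prob_ge0 X _) (fun=> erefl)
  (fun c m => erefl) (fresh_prob_renewal hp0 hp1 hX hk) A hA r.
pose C m := [set w | run_completed k r (fun i => X i w) m].
have detC m : determined_before m.+1 (fun x => run_completed k r x m).
  move=> x y xy; rewrite /run_completed xy//.
  by rewrite (eq_run_state k (fun i lt_im => xy i (ltnW lt_im))).
have mC m : measurable (C m) := prefix_event_measurable hp0 hp1 hX (@detC m).
have PC m : P (C m) = (completion_prob p X k r m.+1)%:E.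
  by rewrite -run_completed_prob// -(prefix_prob_fin hp0 hp1 hX (@detC m)).
have tC : trivIset setT C.
  apply/trivIsetP => i j _ _ ij; apply/seteqP; split=> w // -[/= Ci Cj].
  have := waiting_time_completed hk R Ci.
  rewrite (waiting_time_completed hk R Cj) => -[] /eqP.
  by rewrite eqr_nat eqSS eq_sym (negPf ij).
pose D := \bigcup_m C m.
have mD : measurable D by apply: bigcup_measurable => m _.
have PD : P D = 1%E.
  rewrite measure_bigcup//.
  transitivity (\sum_(m <oo)
      (completion_prob p X k r m.+1 * m.+1%:R ^+ 0)%:E)%E.
    rewrite (@eq_eseriesl R _ xpredT); last by move=> m; rewrite in_setT.
    by apply: eq_eseriesr => m _; rewrite mulr1 -PC.
  (* The moment of order 0: the only multiplicity vector is the empty one. *)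
  rewrite (eseries_moments 0 y0 moments) fact0 mul1r.
  rewrite (big_pred1 [ffun=> ord0]); last first.
    move=> m; rewrite /weighted_size big_ord0 eqxx.
    by symmetry; apply/eqP/ffunP => -[].
  by rewrite /tuple_size !big_ord0 addn0 ffactn0 mulr1.
have PDC : P (~` D) = 0%E by rewrite probability_setC// PD subee.
set f : T -> \bar R := fun w => (waiting_time R k r (fun i => X i w) ^+ n)%E.
have fC m w : C m w -> f w = (m.+1%:R ^+ n)%:E.
  by move=> Cw; rewrite /f (waiting_time_completed hk R Cw) -EFin_expe.
have f_ge0 w : (0 <= f w)%E.
  by apply: expe_ge0; apply: le_ereal_inf_tmp => _ [m _ <-]; rewrite lee_fin.
have mfC m : measurable_fun (C m) f.
  apply: (eq_measurable_fun (cst (m.+1%:R ^+ n : R)%:E)); last exact: measurable_cst.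
  by move=> w; rewrite inE => /fC->.
have mfD : measurable_fun D f by apply/measurable_fun_bigcup.
have mf : measurable_fun setT f.
  rewrite -(setvU D) measurable_funU//; last exact: measurableC.
  (* Off D no r-th run is completed and the waiting time is +oo. *)
  split=> //; apply: (eq_measurable_fun (cst (+oo ^+ n : \bar R)%E)).
    move=> w; rewrite inE => Dw; rewrite /f waiting_time_infinite// => m.
    by apply/negP => Cw; apply: Dw; exists m.
  exact: measurable_cst.
rewrite (ge0_negligible_integral (measurableC mD)) ?setTD ?setCK//; last first.
  by move=> w _; exact: f_ge0.
rewrite ge0_integral_bigcup//; last by move=> w _; exact: f_ge0.
apply: etrans (eseries_moments n y0 moments).
apply: eq_eseriesr => m _; rewrite EFinM -PC muleC -integral_cst//.
by apply: eq_integral => w; rewrite inE => /fC.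
Qed.
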